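(* Let $\mathcal{Q}$ be a concept of qualified subsets. Then (i) if $\mathcal{S}_\mathcal{Q}$ is directed, then $\widehat{S}_\mathcal{Q}$ satisfies retentiveness; (ii) if $\mathcal{R}_{\mathrm{TEQ}}$ is directed, then $\mathcal{S}_\mathcal{Q}$ is directed; (iii) if $\mathcal{R}_{\mathrm{TEQ}}$ is directed, then $\mathrm{TEQ}\subseteq\widehat{S}_\mathcal{Q}$.
   Context: Let $X$ be a universe of alternatives and $\mathcal{F}(X)$ the non-empty finite subsets of $X$. A tournament $T=(A,\succ)$: $A\in\mathcal{F}(X)$, $\succ$ an asymmetric complete relation on $X$. For $B\subseteq A$ write $B$ also for $(B,\succ)$; $B\succ C$ means $b\succ c$ for all $b\in B,c\in C$; $\overline{D}(b)=\{c\in A:c\succ b\}$; $\max_\prec(B)=\{a\in B:\text{no }b\in B\text{ with }b\succ a\}$. A tournament function depends only on $A$ and $\succ|_A$ and commutes with isomorphisms; a tournament solution is a tournament function $S$ with $\max_\prec(A)\subseteq S(T)\subseteq A$, $S(T)\ne\emptyset$. $\mathcal{M}(T)=\{B\subseteq A:\max_\prec(B)\neq\emptyset\}$, $\mathcal{M}_1(T)$ the singletons. A concept of qualified subsets is a tournament function $\mathcal{Q}$ with $\mathcal{M}_1(T)\subseteq\mathcal{Q}(T)\subseteq\mathcal{M}(T)$ satisfying (Closure) $Q\in\mathcal{Q}(T)$, $Q'\subseteq Q$, $Q'\in\mathcal{M}(T)$ imply $Q'\in\mathcal{Q}(T)$; (Independence) for $A'\in\mathcal{F}(X)$, $Q\subseteq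 A\cap A'$: $Q\in\mathcal{Q}((A,\succ))$ iff $Q\in\mathcal{Q}((A',\succ))$; (Fusion) $Q_1,Q_2\in\mathcal{Q}(T)$ and $Q_1\setminus Q_2\succ Q_2$ imply $Q_1\cup Q_2\in\mathcal{Q}(T)$ provided some tournament $T'$ has $Q\in\mathcal{Q}(T')$ with $|Q_1\cup Q_2|\le|Q|$. $S_\mathcal{Q}(T)=\bigcup\{\max_\prec(B):B\text{ inclusion-maximal in }\mathcal{Q}(T)\}$. $B\subseteq A$ is $S$-stable in $T$ if $a\notin S(B\cup\{a\})$ for all $a\in A\setminus B$; $\mathcal{S}_\mathcal{Q}(T)$ is the set of $S_\mathcal{Q}$-stable sets; $\widehat{S}_\mathcal{Q}(T)$ is the union of all inclusion-minimal $S_\mathcal{Q}$-stable sets. $B\subseteq A$ is $S$-retentive in $T$ if $B\neq\emptyset$ and $S(\overline{D}(b))\subseteq B$ for every $b\in B$ with $\overline{D}(b)\ne\emptyset$; $\mathcal{R}_S(T)$ is the set of $S$-retentive sets. A family-valued map $\mathcal{F}$ (such as $\mathcal{S}_\mathcal{Q}$ or $\mathcal{R}_S$) is directed if for every tournament $T$ and $B,C\in\mathcal{F}(T)$ there is $D\in\mathcal{F}(T)$ with $D\subseteq B\cap C$. The tournament equilibrium set $\mathrm{TEQ}$ is defined recursively on the order: $\mathrm{TEQ}(T)$ is the union of all inclusion-minimal $\mathrm{TEQ}$-retentive sets of $T$ (well defined since each $\overline{D}(b)$ has smaller order). A tournament solution $S$ satisfies retentiveness if $S(\overline{D}(a))\subseteq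 S(T)$ for all tournaments $T$ and all $a\in S(T)$ with $\overline{D}(a)\neq\emptyset$. *)

(* Defs.v *)
From mathcomp Require Import all_boot finmap.

Set Implicit Arguments.
Unset Strict Implicit.
Unset Printing Implicit Defensive.

Local Open Scope fset_scope.

Section Tournaments.

Variable X : choiceType.
Implicit Types (A B C D : {fset X}) (d : rel X) (F : {fset {fset X}}).

(* [d a b] reads "a dominates b"; d relates all of X, not only A.  A tournament
   is given unbundled as a set and a relation satisfying [tournament]; maps
   defined on tournaments are total in Rocq, and their values off [tournament]
   are never used. *)
Definition dominance d : Prop :=
  (forall a b, d a b -> ~~ d b a) /\ (forall a b, a != b -> d a b || d b a).

Definition tournament A d : Prop := A != fset0 /\ dominance d.

Definition choice_fun := {fset X} -> rel X -> {fset X}.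
Definition family_fun := {fset X} -> rel X -> {fset {fset X}}.

Definition dominators A d (b : X) : {fset X} := [fset c in A | d c b].

Definition dominates d B C : Prop :=
  forall b c, b \in B -> c \in C -> d b c.

Definition max_dom d B : {fset X} := [fset a in B | all (fun b => ~~ d b a) B].

(* A bijection between alternative sets A and A' is represented by a map on X
   that is injective on A and has image A'; its values off A are irrelevant. *)
Definition isomorphism (p : X -> X) A d A' d' : Prop :=
  [/\ {in A &, injective p}, [fset p a | a in A] = A'
    & {in A &, forall a b, d' (p a) (p b) = d a b}].

Definition tournament_family_fun (f : family_fun) : Prop :=
  (forall A d d', tournament A d -> tournament A d' ->
     {in A &, d =2 d'} -> f A d = f A d') /\
  (forall A d A' d' (p : X -> X), tournament A d -> tournament A' d' ->
     isomorphism p A d A' d' ->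
     f A' d' = [fset [fset p a | a in (B : {fset X})] | B in f A d]).

Definition inclusion_maximal F : {fset {fset X}} :=
  [fset B in F | all (fun C => ~~ (B `<` C)) F].

Definition inclusion_minimal F : {fset {fset X}} :=
  [fset B in F | all (fun C => ~~ (C `<` B)) F].

Definition with_max A d : {fset {fset X}} :=
  [fset B in fpowerset A | max_dom d B != fset0].

Record qualified_concept (Q : family_fun) : Prop := QualifiedConcept {
  qualified_tournament_fun : tournament_family_fun Q;
  qualified_singleton : forall A d a, tournament A d ->
    a \in A -> [fset a] \in Q A d;
  qualified_with_max : forall A d, tournament A d -> Q A d `<=` with_max A d;
  qualified_closure : forall A d B B', tournament A d ->
    B \in Q A d -> B' `<=` B -> B' \in with_max A d -> B' \in Q A d;
  qualified_independence : forall A A' d B,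
    tournament A d -> tournament A' d -> B `<=` A `&` A' ->
    (B \in Q A d <-> B \in Q A' d);
  qualified_fusion : forall A d B1 B2, tournament A d ->
    B1 \in Q A d -> B2 \in Q A d -> dominates d (B1 `\` B2) B2 ->
    (exists A' d' B, [/\ tournament A' d', B \in Q A' d'
                       & #|` B1 `|` B2| <= #|` B|]) ->
    B1 `|` B2 \in Q A d
}.

Definition qualified_solution (Q : family_fun) : choice_fun := fun A d =>
  \bigcup_(B <- inclusion_maximal (Q A d)) max_dom d B.

Definition stable_sets (S : choice_fun) : family_fun := fun A d =>
  [fset B in fpowerset A | all (fun a => a \notin S (a |` B) d) (A `\` B)].

Definition minimal_stable_union (Q : family_fun) : choice_fun := fun A d =>
  \bigcup_(B <- inclusion_minimal (stable_sets (qualified_solution Q) A d)) B.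

Definition retentive_sets (S : choice_fun) : family_fun := fun A d =>
  [fset B in fpowerset A | (B != fset0) &&
     all (fun b => (dominators A d b != fset0) ==>
                   (S (dominators A d b) d `<=` B)) B].

(* The recursion on the order of the tournament is driven by a bound n on that
   order; [TEQE] below is the defining equation. *)
Fixpoint TEQ_rec (n : nat) : choice_fun := fun A d =>
  if n is n'.+1 then
    \bigcup_(B <- inclusion_minimal (retentive_sets (TEQ_rec n') A d)) B
  else fset0.

Definition TEQ : choice_fun := fun A d => TEQ_rec #|` A| A d.

Lemma retentive_sets_eq (S S' : choice_fun) A d :
    {in A, forall b, S (dominators A d b) d = S' (dominators A d b) d} ->
  retentive_sets S A d = retentive_sets S' A d.
Proof.
move=> eqS; apply/fsetP => B; rewrite !inE fpowersetE.
case sBA: (B `<=` A) => //=; congr (_ && _).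
by apply: eq_in_all => b Bb; rewrite eqS // (fsubsetP sBA).
Qed.

Lemma dominators_card A d b : irreflexive d -> b \in A ->
  #|` dominators A d b| < #|` A|.
Proof.
move=> dI Ab; apply: fproper_ltn_card; rewrite fproperE.
apply/andP; split; first by apply/fsubsetP => c; rewrite !inE => /andP[].
by apply/fsubsetPn; exists b => //; rewrite !inE dI andbF.
Qed.

Lemma TEQ_rec_stab n A d : irreflexive d -> #|` A| <= n ->
  TEQ_rec n A d = TEQ A d.
Proof.
move=> dI; rewrite /TEQ.
suff H m k C : #|` C| <= m -> #|` C| <= k -> TEQ_rec m C d = TEQ_rec k C d.
  by move=> leAn; apply: H.
have E0 j : TEQ_rec j fset0 d = fset0.
  case: j => //= j; suff -> : retentive_sets (TEQ_rec j) fset0 d = fset0.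
    rewrite (_ : inclusion_minimal _ = fset0) ?big_seq_fset0 //.
    by apply/fsetP => B; rewrite !inE.
  apply/fsetP => B; rewrite !inE fpowersetE fsubset0.
  by case: eqP => // ->.
elim: m k C => [|m IHm] [|k] C.
- by [].
- by rewrite leqn0 cardfs_eq0 => /eqP-> _; rewrite !E0.
- by move=> _; rewrite leqn0 cardfs_eq0 => /eqP->; rewrite !E0.
move=> leCm leCk /=.
rewrite (@retentive_sets_eq _ (TEQ_rec k)) // => b Cb.
have lt := dominators_card dI Cb.
by apply: IHm; rewrite -ltnS; apply: leq_trans lt _.
Qed.

Lemma TEQE A d : tournament A d ->
  TEQ A d = \bigcup_(B <- inclusion_minimal (retentive_sets TEQ A d)) B.
Proof.
case=> A0 [dA _].
have dI : irreflexive d.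
  by move=> a; apply/negP => daa; move: (dA _ _ daa); rewrite daa.
rewrite -(@TEQ_rec_stab #|` A|.+1) //=.
rewrite (@retentive_sets_eq _ TEQ) // => b Ab.
exact/TEQ_rec_stab/ltnW/dominators_card.
Qed.

Definition directed (f : family_fun) : Prop :=
  forall A d B C, tournament A d -> B \in f A d -> C \in f A d ->
  exists2 D, D \in f A d & D `<=` B `&` C.

Definition retentiveness (S : choice_fun) : Prop :=
  forall A d a, tournament A d -> a \in S A d -> dominators A d a != fset0 ->
  S (dominators A d a) d `<=` S A d.

End Tournaments.

(* Main.v *)
(** If B is stable in A and b is in B, then B meets the dominators of b in a set
    that is stable among them; this gives (i).  By induction on the order, if the
    TEQ-retentive sets are directed then every stable set is TEQ-retentive, hence
    contains TEQ; this gives (iii), and it shows that any two sets stable for the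
    same concept intersect.  For (ii), the intersection of stable sets B and C is
    stable: if P is the part below the top of a qualified set that might violate
    this, the sets R above P with R `|` P qualified again form a concept, for which
    the traces of B and C are stable, so these traces share an element. *)

Require Import Defs.
From mathcomp Require Import all_boot finmap.

Local Open Scope fset_scope.

Section LocalConcepts.
Set Implicit Arguments.
Unset Strict Implicit.
Unset Printing Implicit Defensive.

Variables (X : choiceType) (d : rel X).
Hypothesis dP : dominance d.
Implicit Types (a b x : X) (A B C M N P R V : {fset X}) (q : pred {fset X}).

(** * Local concepts and their stable sets *)

Definition is_top a M := a \in M /\ {in M, forall b, b != a -> d a b}.

(* The axioms of a concept of qualified subsets on the subsets of a single
   tournament.  Invariance under isomorphism is dropped, so that [link_concept]
   below is an instance. *)
Record local_concept A q : Prop := LocalConcept {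
  local_top : forall M, M `<=` A -> q M -> exists a, is_top a M;
  local_singleton : forall a, a \in A -> q [fset a];
  local_closure : forall M N a, M `<=` A -> q M -> N `<=` M -> is_top a N -> q N;
  local_fusion : forall M1 M2 N, M1 `<=` A -> M2 `<=` A -> N `<=` A ->
    q M1 -> q M2 -> q N -> dominates d (M1 `\` M2) M2 ->
    #|` M1 `|` M2| <= #|` N| -> q (M1 `|` M2)
}.

(* Equivalent to S_Q-stability, see [mem_stable_sets]. *)
Definition local_stable A q B : Prop :=
  B `<=` A /\
  forall a M, a \in A -> a \notin B -> M `<=` a |` B -> q M -> is_top a M ->
  exists x, [/\ x \in B, {in M, forall y, d x y} & q (x |` M)].

Lemma dominance_irr : irreflexive d.
Proof.
by move=> a; apply/negP => daa; move: (dP.1 _ _ daa); rewrite daa.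
Qed.

Lemma is_topU1 x M : {in M, forall y, d x y} -> is_top x (x |` M).
Proof.
move=> xM; split; first exact: fset1U1.
by move=> y /fset1UP[->|/xM //]; rewrite eqxx.
Qed.

Lemma dominating_notin x M : {in M, forall y, d x y} -> x \notin M.
Proof. by move=> xM; apply/negP => /xM; rewrite dominance_irr. Qed.

Lemma mem_max_dom a M : reflect (is_top a M) (a \in max_dom d M).
Proof.
rewrite !inE; apply: (iffP andP) => [[aM /allP aT]|[aM aT]]; split => //.
  by move=> b bM ba; have /orP[dba|//] := dP.2 _ _ ba; case/negP: (aT b bM).
apply/allP => b bM; have [->|/(aT b bM) /dP.1 //] := eqVneq b a.
by rewrite dominance_irr.
Qed.

(** The axioms concern subsets of the ambient set only, and in fusion the size witness must now fit
    into the smaller [V], so less is demanded. *)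
Lemma local_conceptS A V q : local_concept A q -> V `<=` A -> local_concept V q.
Proof.
case=> tA sA cA fA VA; split.
- by move=> M MV; apply/tA/(fsubset_trans MV).
- by move=> a aV; apply/sA/(fsubsetP VA).
- by move=> M N a MV; apply/cA/(fsubset_trans MV).
- by move=> M1 M2 N M1V M2V NV; apply: fA; apply: fsubset_trans VA.
Qed.

Lemma dominators_sub A b : dominators A d b `<=` A.
Proof. by apply/fsubsetP => c; rewrite !inE => /andP[]. Qed.

(** If [a] lies outside [B], its singleton is qualified with top [a], and stability must answer it
    with an element of [B]. *)
Lemma local_stable_neq0 A q B :
  local_concept A q -> local_stable A q B -> A != fset0 -> B != fset0.
Proof.
move=> cA [_ stB] /fset0Pn[a aA]; have [aB|aB] := boolP (a \in B).
  by apply/fset0Pn; exists a.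
have [|x [xB _ _]] := stB a [fset a] aA aB (fsubsetUl _ _) (local_singleton cA aA).
  by split; rewrite ?inE // => b; rewrite inE => ->.
by apply/fset0Pn; exists x.
Qed.

(* Stability is applied twice: first to M, to see that M is not of the largest
   qualified size, so that fusion adds b below M, and then to b |` M. *)
Lemma local_stable_dominators A q B b :
  local_concept A q -> local_stable A q B -> b \in B ->
  local_stable (dominators A d b) q (B `&` dominators A d b).
Proof.
move=> cA [BA stB] bB; split; first exact: fsubsetIr.
move=> a M aDb; rewrite inE aDb andbT => aB MB qM aM.
have [aA dab] : a \in A /\ d a b by move: aDb; rewrite !inE => /andP.
have aBA : a |` B `<=` A by rewrite fsubUset fsub1set aA.
have MaB : M `<=` a |` B by apply: fsubset_trans MB (fsetUS _ (fsubsetIl _ _)).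
have Mb : {in M, forall y, d y b}.
  by move=> y /(fsubsetP MB); rewrite !inE => /orP[/eqP->|/and3P[]].
have bM : b \notin M by apply/negP => /Mb; rewrite dominance_irr.
have bA := fsubsetP BA _ bB.
have [y [yB yM qyM]] := stB a M aA aB MaB qM aM.
have qMb : q (M `|` [fset b]).
  apply: (local_fusion cA) (qM) (local_singleton cA bA) qyM _ _.
  - exact: fsubset_trans aBA.
  - by rewrite fsub1set.
  - by rewrite fsubUset fsub1set (fsubsetP BA) //; apply: fsubset_trans aBA.
  - by move=> z c /fsetDP[zM _] /fset1P->; apply: Mb.
  - by rewrite fsetUC !cardfsU1 bM dominating_notin.
have [||x [xB xMb qx]] := stB a (M `|` [fset b]) aA aB _ qMb.
- by rewrite fsubUset MaB fsub1set fset1Ur.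
- split; first by rewrite inE aM.1.
  by move=> z /fsetUP[/aM.2 //|/fset1P->].
have xM : {in M, forall y, d x y} by move=> z zM; apply: xMb; rewrite inE zM.
exists x; split => //.
  by rewrite !inE xB (fsubsetP BA) //= xMb // !inE eqxx orbT.
apply: (local_closure cA) qx _ (is_topU1 xM).
  rewrite !fsubUset !fsub1set (fsubsetP BA) //= bA andbT.
  exact: fsubset_trans aBA.
exact/fsetUS/fsubsetUl.
Qed.

(** * Extremal members of set families and directedness *)

Lemma inclusion_minimal_exists (F : {fset {fset X}}) B :
  B \in F -> exists2 C, C \in inclusion_minimal F & C `<=` B.
Proof.
have [n] := ubnP #|` B|; elim: n B => // n IHn B leBn BF.
have [/allP minB|/allPn[C CF]] := boolP (all (fun C => ~~ (C `<` B)) F).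
  by exists B => //; rewrite !inE BF; apply/allP.
rewrite negbK => CB.
have [|D Dmin DC] := IHn C _ CF.
  exact: leq_trans (fproper_ltn_card CB) leBn.
by exists D => //; apply: fsubset_trans DC (fproper_sub CB).
Qed.

Lemma inclusion_maximal_exists (F : {fset {fset X}}) A B :
  {in F, forall C, C `<=` A} -> B \in F ->
  exists2 C, C \in inclusion_maximal F & B `<=` C.
Proof.
move=> FA; have [n] := ubnP (#|` A| - #|` B|); elim: n B => // n IHn B leBn BF.
have [/allP maxB|/allPn[C CF]] := boolP (all (fun C => ~~ (B `<` C)) F).
  by exists B => //; rewrite !inE BF; apply/allP.
rewrite negbK => BC; have ltBC := fproper_ltn_card BC.
have [|D Dmax CD] := IHn C _ CF.
  rewrite -ltnS; apply: leq_trans leBn; rewrite ltnS; apply: ltn_sub2l => //.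
  exact: leq_trans ltBC (fsubset_leq_card (FA _ CF)).
by exists D => //; apply: fsubset_trans (fproper_sub BC) CD.
Qed.

Lemma mem_inclusion_minimal (F : {fset {fset X}}) B : B \in inclusion_minimal F ->
  B \in F /\ forall C, C \in F -> C `<=` B -> C = B.
Proof.
rewrite !inE => /andP[BF /allP minB]; split => // C CF CB.
by apply/eqP; rewrite eqEfproper CB; apply: minB.
Qed.

(** Directedness puts a member inside both [B] and [C], and minimality identifies it with [B]; so a
    minimal member is the least one. *)
Lemma directed_minimal_sub (f : family_fun X) A B C : tournament A d ->
  directed f -> B \in inclusion_minimal (f A d) -> C \in f A d -> B `<=` C.
Proof.
move=> tA dirf /mem_inclusion_minimal[BF minB] CF.
have [D DF] := dirf A d B C tA BF CF; rewrite fsubsetI => /andP[DB DC].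
by rewrite -(minB D DF DB).
Qed.

Lemma mem_bigcup_fset (F : {fset {fset X}}) (f : {fset X} -> {fset X}) x :
  reflect (exists2 B, B \in F & x \in f B) (x \in \bigcup_(B <- F) f B).
Proof.
apply: (iffP (bigfcupP F x f xpredT)) => [[B]|[B BF xB]]; last by exists B; rewrite ?BF.
by rewrite andbT; exists B.
Qed.

(** * TEQ and stable sets *)

Lemma TEQ_sub A : tournament A d -> TEQ A d `<=` A.
Proof.
move=> tA; rewrite TEQE //; apply/fsubsetP => x /mem_bigcup_fset[B].
by move=> /mem_inclusion_minimal[]; rewrite !inE fpowersetE => /andP[/fsubsetP + _] _; apply.
Qed.

Lemma TEQ_neq0 A : tournament A d -> TEQ A d != fset0.
Proof.
move=> tA; have retA : A \in retentive_sets (@TEQ X) A d.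
  rewrite !inE fpowersetE fsubset_refl tA.1; apply/allP => b bA.
  apply/implyP => Db; apply: fsubset_trans (dominators_sub A b).
  by apply: TEQ_sub; split.
have [C Cmin _] := inclusion_minimal_exists retA.
have [] := mem_inclusion_minimal Cmin.
rewrite !inE => /and3P[_ /fset0Pn[x xC] _] _.
by apply/fset0Pn; exists x; rewrite TEQE //; apply/mem_bigcup_fset; exists C.
Qed.

(** Retentiveness of [B] at [b] is the induction hypothesis for the dominators of [b], where [B]
    leaves a stable trace. Keeping [q] arbitrary makes the result available for links. *)
Lemma TEQ_sub_local_stable A q B : directed (retentive_sets (@TEQ X)) ->
  A != fset0 -> local_concept A q -> local_stable A q B -> TEQ A d `<=` B.
Proof.
move=> dirR; have [n] := ubnP #|` A|; elim: n A B => // n IHn A B leAn A0 cA stB.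
have tA : tournament A d by split.
suff retB : B \in retentive_sets (@TEQ X) A d.
  rewrite TEQE //; apply/fsubsetP => x /mem_bigcup_fset[C Cmin].
  exact/fsubsetP/(directed_minimal_sub tA dirR).
rewrite !inE fpowersetE stB.1 (local_stable_neq0 cA stB A0); apply/allP => b bB.
apply/implyP => Db; apply: fsubset_trans (fsubsetIl _ (dominators A d b)).
apply: IHn Db (local_conceptS cA (dominators_sub A b)) _.
  rewrite -ltnS; apply: leq_trans leAn; rewrite ltnS; apply: dominators_card dominance_irr _.
  exact: (fsubsetP stB.1).
exact: local_stable_dominators.
Qed.

(** * Links, and intersections of stable sets *)

Definition link A q P := [fset v in A | all (d v) P && q (v |` P)].
(* The empty set is excluded because P itself may be qualified. *)
Definition link_concept q P : pred {fset X} :=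
  fun R => (R != fset0) && q (R `|` P).

Lemma mem_link A q P v : reflect
  [/\ v \in A, {in P, forall y, d v y} & q (v |` P)] (v \in link A q P).
Proof.
rewrite !inE; apply: (iffP and3P) => [[vA /allP vP qv]|[vA vP qv]].
  by split.
by split => //; apply/allP.
Qed.

Lemma link_topU A q P R a : R `<=` link A q P -> is_top a R -> is_top a (R `|` P).
Proof.
move=> RV [aR aT]; split; first by rewrite inE aR.
move=> y /fsetUP[/aT //|yP _].
by have /mem_link[_ aP _] := fsubsetP RV _ aR; apply: aP.
Qed.

(** Each axiom is that of [q] with [P] added to the sets involved. Elements of the link dominate
    [P], so adding [P] keeps tops, and disjointness from [P] shifts both sizes in fusion by the same
    amount. *)
Lemma local_concept_link A q P : local_concept A q -> P `<=` A ->
  local_concept (link A q P) (link_concept q P).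
Proof.
move=> cA PA.
have VA R : R `<=` link A q P -> R `|` P `<=` A.
  rewrite fsubUset PA andbT => RV; apply: fsubset_trans RV _.
  by apply/fsubsetP => v /mem_link[].
have cardUP R : R `<=` link A q P -> #|` R `|` P| = (#|` R| + #|` P|)%N.
  move=> RV; rewrite cardfsU; suff -> : R `&` P = fset0 by rewrite cardfs0 subn0.
  apply/eqP; rewrite -fsubset0; apply/fsubsetP => v /fsetIP[/(fsubsetP RV)].
  by case/mem_link => _ /dominating_notin/negP.
split.
- move=> R RV /andP[/fset0Pn[r rR] qRP].
  have [z [zRP zT]] := local_top cA (VA R RV) qRP; exists z.
  have [_ rP _] := mem_link _ _ _ _ (fsubsetP RV _ rR).
  have zR : z \in R.
    case/fsetUP: zRP => // zP; have drz := rP z zP.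
    have rz : r != z by apply: contraTneq drz => ->; rewrite dominance_irr.
    by case/negP: (dP.1 _ _ drz); apply: zT; rewrite // inE rR.
  by split => // b bR; apply: zT; rewrite inE bR.
- move=> a /mem_link[_ _ qa]; rewrite /link_concept qa andbT.
  by apply/fset0Pn; exists a; rewrite inE.
- move=> M N a MV /andP[_ qM] NM aN; rewrite /link_concept.
  have NV := fsubset_trans NM MV; apply/andP; split.
    by apply/fset0Pn; exists a; apply: aN.1.
  apply: (local_closure cA) qM _ (link_topU NV aN); first exact: VA.
  exact: fsetSU.
move=> M1 M2 N M1V M2V NV /andP[/fset0Pn[m mM1] q1] /andP[_ q2] /andP[_ qN] dom le.
apply/andP; split; first by apply/fset0Pn; exists m; rewrite inE mM1.
have -> : M1 `|` M2 `|` P = (M1 `|` P) `|` (M2 `|` P).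
  by rewrite fsetUACA fsetUid.
apply: (local_fusion cA) (VA _ M1V) (VA _ M2V) (VA _ NV) q1 q2 qN _ _.
  move=> b c /fsetDP[/fsetUP[bM1|bP]]; last by rewrite inE bP orbT.
  rewrite inE negb_or => /andP[bM2 _] /fsetUP[cM2|cP].
    by apply: dom => //; rewrite inE bM2.
  by have /mem_link[_ bP _] := fsubsetP M1V _ bM1; apply: bP.
have -> : (M1 `|` P) `|` (M2 `|` P) = (M1 `|` M2) `|` P.
  by rewrite fsetUACA fsetUid.
by rewrite !cardUP ?leq_add2r // fsubUset M1V.
Qed.

(** A set [R] with top [c] is tested through its union with [P]. The element [x] of [B] found above
    that union is itself in the link, by closure. *)
Lemma local_stable_link A q P B : local_concept A q -> P `<=` B ->
  local_stable A q B ->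
  local_stable (link A q P) (link_concept q P) (B `&` link A q P).
Proof.
move=> cA PB [BA stB]; split; first exact: fsubsetIr.
move=> c R cV; rewrite inE cV andbT => cB RB /andP[R0 qR] cR.
have [cA' cP qc] := mem_link _ _ _ _ cV.
have RV : R `<=` link A q P.
  by apply: fsubset_trans RB _; rewrite fsubUset fsub1set cV fsubsetIr.
have RPB : R `|` P `<=` c |` B.
  rewrite fsubUset (fsubset_trans RB) ?(fsetUS _ (fsubsetIl _ _)) //=.
  exact: fsubset_trans PB (fsubsetUr _ _).
have [x [xB xRP qx]] := stB _ _ cA' cB RPB qR (link_topU RV cR).
have xR : {in R, forall y, d x y} by move=> y yR; apply: xRP; rewrite inE yR.
have xP : {in P, forall y, d x y}.
  by move=> y yP; apply: xRP; rewrite inE yP orbT.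
exists x; split => //.
  rewrite inE xB; apply/mem_link; split => //; first exact: (fsubsetP BA).
  apply: (local_closure cA) qx _ (is_topU1 xP); last exact/fsetUS/fsubsetUr.
  rewrite fsubUset fsub1set (fsubsetP BA) //= (fsubset_trans RPB) //.
  by rewrite fsubUset fsub1set cA'.
rewrite /link_concept -fsetUA qx andbT.
by apply/fset0Pn; exists x; apply: fset1U1.
Qed.

(* The traces of B and C on the link of P = M `\ a are stable there, hence share
   some x.  Either x dominates a and extends M on top, or x is dominated by a and
   M grows to x |` M, still with top a. *)
Lemma local_stableI A q B C : directed (retentive_sets (@TEQ X)) ->
  local_concept A q -> local_stable A q B -> local_stable A q C ->
  local_stable A q (B `&` C).
Proof.
move=> dirR cA stB stC; split; first exact: fsubset_trans (fsubsetIl _ _) stB.1.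
(* [M] will grow while keeping its top [a], so the induction is on the number of elements of [A]
   outside [M]. *)
move=> a M aA aBC; have [n] := ubnP (#|` A| - #|` M|).
elim: n M => // n IHn M leMn MBC qM aM.
have aMA : a |` (B `&` C) `<=` A.
  by rewrite fsubUset fsub1set aA (fsubset_trans (fsubsetIl _ _) stB.1).
have MA := fsubset_trans MBC aMA.
set P := M `\ a.
have MP : a |` P = M by apply: fsetD1K; exact: aM.1.
have PBC : P `<=` B `&` C.
  apply/fsubsetP => y /fsetD1P[ya /(fsubsetP MBC)/fset1UP[yE|//]].
  by rewrite yE eqxx in ya.
have [PB PC] : P `<=` B /\ P `<=` C by move: PBC; rewrite fsubsetI => /andP.
have aP : {in P, forall y, d a y} by move=> y /fsetD1P[ya yM]; apply: aM.2.
have PA := fsubset_trans PB stB.1.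
(* [a] misses [B] or [C], and stability of that set gives [y], which may miss the other one. It
   serves only to provide a qualified set with one element more than [M], the size witness for both
   fusions below. *)
have [y [yA yM qyM]] : exists y,
    [/\ y \in A, {in M, forall z, d y z} & q (y |` M)].
  suff ext D : P `<=` D -> local_stable A q D -> a \notin D -> exists y,
      [/\ y \in A, {in M, forall z, d y z} & q (y |` M)].
    by move: aBC; rewrite inE negb_and => /orP[]; [exact: ext|exact: ext].
  move=> PD [DA stD] aD; have [|y [yD yM qyM]] := stD a M aA aD _ qM aM.
    by rewrite -MP fsetUS.
  by exists y; split => //; apply: (fsubsetP DA).
have V0 : link A q P != fset0.
  by apply/fset0Pn; exists a; apply/mem_link; rewrite MP.
have cV := local_concept_link cA PA.
have [x xT] : exists x, x \in TEQ (link A q P) d.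
  by apply/fset0Pn/TEQ_neq0; split.
have /fsetIP[xB /mem_link[xA xP qx]] :=
  fsubsetP (TEQ_sub_local_stable dirR V0 cV (local_stable_link cA PB stB)) x xT.
have /fsetIP[xC _] :=
  fsubsetP (TEQ_sub_local_stable dirR V0 cV (local_stable_link cA PC stC)) x xT.
have xBC : x \in B `&` C by rewrite inE xB.
have xa : x != a by apply: contraNneq aBC => <-.
have xM : x \notin M by rewrite -MP in_fset1U negb_or xa (dominating_notin xP).
have lexM : #|` x |` M| <= #|` y |` M|.
  by rewrite !cardfsU1 xM (dominating_notin yM).
have yMA : y |` M `<=` A by rewrite fsubUset fsub1set yA.
have xMA : x |` M `<=` A by rewrite fsubUset fsub1set xA.
have /orP[dxa|dax] := dP.2 _ _ xa.
  have xtop : {in M, forall z, d x z}.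
    by rewrite -MP => z /fset1UP[->|/xP].
  exists x; split => //.
  apply: (local_fusion cA) (local_singleton cA xA) qM qyM _ lexM => //.
    by rewrite fsub1set.
  by move=> b c /fsetDP[/fset1P-> _]; apply: xtop.
have xME : x |` M = [fset a] `|` (x |` P) by rewrite -MP fsetUCA.
have qxM : q (x |` M).
  rewrite xME; apply: (local_fusion cA) (local_singleton cA aA) qx qyM _ _ => //.
  - by rewrite fsub1set.
  - by rewrite fsubUset fsub1set xA.
  - by move=> b c /fsetDP[/fset1P-> _] /fset1UP[->|/aP].
  - by rewrite -xME.
have [|||z [zBC zxM qz]] := IHn (x |` M) _ _ qxM.
- rewrite -ltnS; apply: leq_trans leMn; rewrite ltnS; apply: ltn_sub2l.
    apply: leq_trans (fsubset_leq_card xMA).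
    by rewrite cardfsU1 xM.
  by rewrite cardfsU1 xM.
- by rewrite fsubUset MBC fsub1set fset1Ur.
- split; first by rewrite fset1Ur // aM.1.
  by move=> b /fset1UP[->|/aM.2].
have zM : {in M, forall y, d z y} by move=> b bM; apply/zxM/fset1Ur.
(* [z] was found above the enlarged set; closure discards [x] again. *)
exists z; split => //; apply: (local_closure cA) qz _ (is_topU1 zM).
  rewrite fsubUset xMA fsub1set andbT.
  by apply: (fsubsetP stB.1); case/fsetIP: zBC.
exact/fsetUS/fsubsetUr.
Qed.

(** * From concepts of qualified subsets to local concepts *)

Variable Q : family_fun X.
Hypothesis hQ : qualified_concept Q.

(* By independence, qualification of M can be tested in the tournament M itself. *)
Definition qualified : pred {fset X} := fun M => (M != fset0) && (M \in Q M d).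

Lemma mem_qualified A M : tournament A d ->
  (M \in Q A d) = (M `<=` A) && qualified M.
Proof.
move=> tA.
have indep : M `<=` A -> M != fset0 -> M \in Q A d <-> M \in Q M d.
  move=> MA M0; apply: (qualified_independence hQ tA (conj M0 dP)).
  by rewrite fsubsetI MA fsubset_refl.
apply/idP/andP => [MQ|[MA /andP[M0 MQ]]]; last by apply/indep.
(* Having a maximum makes [M] non-empty, hence a tournament to which independence applies. *)
have := fsubsetP (qualified_with_max hQ tA) _ MQ.
rewrite !inE fpowersetE => /andP[MA /fset0Pn[a]].
rewrite !inE => /andP[aM _]; have M0 : M != fset0 by apply/fset0Pn; exists a.
by split; rewrite // /qualified M0; apply/indep.
Qed.

Lemma local_concept_qualified A : tournament A d -> local_concept A qualified.
Proof.
move=> tA; have mQ M := mem_qualified M tA; split.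
- move=> M MA qM; have MQ : M \in Q A d by rewrite mQ MA.
  have := fsubsetP (qualified_with_max hQ tA) _ MQ.
  by rewrite !inE fpowersetE MA => /fset0Pn[a /mem_max_dom]; exists a.
- by move=> a /(qualified_singleton hQ tA); rewrite mQ => /andP[].
- move=> M N a MA qM NM aN; have MQ : M \in Q A d by rewrite mQ MA.
  suff : N \in Q A d by rewrite mQ => /andP[].
  apply: (qualified_closure hQ tA MQ NM).
  rewrite !inE fpowersetE (fsubset_trans NM MA).
  by apply/fset0Pn; exists a; apply/mem_max_dom.
move=> M1 M2 N M1A M2A NA q1 q2 qN dom le.
suff : M1 `|` M2 \in Q A d by rewrite mQ => /andP[].
apply: (qualified_fusion hQ tA) => //; rewrite ?mQ ?M1A ?M2A //.
by exists A, d, N; split => //; rewrite mQ NA.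
Qed.

(** For one direction, [M] is extended to a maximal qualified [N], whose top cannot be [a] and so
    lies in [B]; closure cuts [N] down. Conversely, a maximal [M] with top [a] could be enlarged by
    [x]. *)
Lemma mem_stable_sets A B : tournament A d ->
  reflect (local_stable A qualified B)
          (B \in stable_sets (qualified_solution Q) A d).
Proof.
move=> tA; rewrite !inE fpowersetE.
have taB a : tournament (a |` B) d.
  by split => //; apply/fset0Pn; exists a; apply: fset1U1.
apply: (iffP andP) => -[BA stB]; split => //.
  move=> a M aA aB MaB qM aM.
  have MQ : M \in Q (a |` B) d by rewrite mem_qualified // MaB.
  have [|N Nmax MN] := @inclusion_maximal_exists _ (a |` B) _ _ MQ.
    by move=> N; rewrite mem_qualified // => /andP[].
  have : N \in Q (a |` B) d by move: Nmax; rewrite !inE => /andP[].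
  rewrite mem_qualified // => /andP[NaB qN].
  have cB := local_concept_qualified (taB a).
  have [x xN] := local_top cB NaB qN.
  have xa : x != a.
    apply/eqP => xE; rewrite xE in xN.
    have /(allP stB)/negP[] : a \in A `\` B by rewrite inE aB.
    by apply/mem_bigcup_fset; exists N => //; apply/mem_max_dom.
  have aN := fsubsetP MN _ aM.1.
  have dxa : d x a by apply: xN.2; rewrite // eq_sym.
  have xM : {in M, forall y, d x y}.
    move=> y yM; apply: xN.2; first exact: (fsubsetP MN).
    (* [x] is outside [M], since otherwise the top [a] of [M] would dominate it. *)
    apply: contraTneq dxa => yx; rewrite yx in yM.
    by rewrite (negPf (dP.1 _ _ (aM.2 _ yM xa))).
  exists x; split => //.
    by have /fset1UP[xE|//] := fsubsetP NaB _ xN.1; rewrite xE eqxx in xa.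
  apply: (local_closure cB) NaB qN _ (is_topU1 xM).
  by rewrite fsubUset fsub1set xN.1.
apply/allP => a /fsetDP[aA aB]; apply/negP => /mem_bigcup_fset[M + /mem_max_dom aM].
rewrite !inE => /andP[MQ /allP maxM].
move: (MQ); rewrite mem_qualified // => /andP[MaB qM].
have [x [xB xM qx]] := stB a M aA aB MaB qM aM.
have /maxM/negP[] : x |` M \in Q (a |` B) d.
  by rewrite mem_qualified // fsubUset MaB fsub1set fset1Ur.
by rewrite fproperE fsubsetUr; apply/fsubsetPn; exists x;
  rewrite ?fset1U1 ?dominating_notin.
Qed.

End LocalConcepts.

Theorem theorem6 (X : choiceType)
    (Q : {fset X} -> rel X -> {fset {fset X}}) (hQ : qualified_concept Q) :
  [/\ directed (stable_sets (qualified_solution Q)) ->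
        retentiveness (minimal_stable_union Q),
      directed (retentive_sets (@TEQ X)) ->
        directed (stable_sets (qualified_solution Q))
    & directed (retentive_sets (@TEQ X)) ->
        forall (A : {fset X}) (d : rel X), tournament A d ->
          TEQ A d `<=` minimal_stable_union Q A d].
Proof.
split.
- move=> dirS A d a tA /mem_bigcup_fset[B Bmin aB] Da.
  have dP := tA.2.
  have tD : tournament (dominators A d a) d by [].
  have [/(mem_stable_sets dP hQ _ tA) stB _] := mem_inclusion_minimal Bmin.
  have stD := local_stable_dominators dP (local_concept_qualified dP hQ tA) stB aB.
  apply/fsubsetP => x /mem_bigcup_fset[E Emin xE]; apply/mem_bigcup_fset; exists B => //.
  have /fsubsetP/(_ x xE) : E `<=` B `&` dominators A d a.
    by apply: (directed_minimal_sub tD dirS Emin); apply/mem_stable_sets.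
  by case/fsetIP.
- move=> dirR A d B C tA /(mem_stable_sets tA.2 hQ _ tA) stB.
  move=> /(mem_stable_sets tA.2 hQ _ tA) stC; exists (B `&` C) => //.
  apply/(mem_stable_sets tA.2 hQ _ tA).
  exact: local_stableI tA.2 _ _ _ _ dirR (local_concept_qualified tA.2 hQ tA) stB stC.
move=> dirR A d tA; have dP := tA.2.
(* [A] is vacuously stable, so a minimal stable set exists; one suffices, as every stable set
   contains TEQ. *)
have stA : A \in stable_sets (qualified_solution Q) A d.
  apply/(mem_stable_sets dP hQ _ tA); split => // a M aA /negP[] //.
have [B Bmin _] := inclusion_minimal_exists stA.
have [/(mem_stable_sets dP hQ _ tA) stB _] := mem_inclusion_minimal Bmin.
apply/fsubsetP => x xT; apply/mem_bigcup_fset; exists B => //.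
by apply: (fsubsetP _ x xT); apply: (TEQ_sub_local_stable dP dirR tA.1 _ stB);
  apply: local_concept_qualified.
Qed.
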